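(* There exists a deterministic weak-probe local computation algorithm for weak $3$-coloring that, on every input graph with $n$ vertices and for every queried vertex, uses at most $\log^* n + O(1)$ weak probes.
   Context: The input is a simple undirected graph $G=(V,E)$ with $n$ vertices carrying distinct IDs, represented as an array with one row per vertex $v$: cell $(v,0)$ holds the degree $d_v$, cell $(v,j)$ for $1\le j\le d_v$ holds the ID of the neighbor at $v$'s $j$-th port (ports in arbitrary order). A weak probe specifies a single cell $(v,j)$ and returns its content. A deterministic local computation algorithm (LCA) receives a query (here a vertex $v$), makes probes to the input, and returns an answer (here a color for $v$); its answers to all possible queries must be consistent with a single global feasible solution. Its probe complexity is the maximum number of probes used to answer a query. A weak $c$-coloring is a map $col:V\to\{1,\dots,c\}$ such that every non-isolated vertex $v$ has a neighbor $u$ with $col(u)\ne col(v)$.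
   Formalization: The distinct IDs are assumed to be natural numbers at most n^k for a fixed exponent k, with the algorithm and the O(1) constant depending on k; without a bound on the IDs in terms of n the claim fails. *)

(* Defs.v *)
From HB Require Import structures.
From mathcomp Require Import all_boot.

Set Implicit Arguments.
Unset Strict Implicit.
Unset Printing Implicit Defensive.

Record input (V : finType) := Input {
  adj : rel V;
  adj_sym : symmetric adj;
  adj_irr : irreflexive adj;
  (* the neighbors of each vertex, in the (arbitrary) order of its ports *)
  ports : V -> seq V;
  ports_uniq : forall v, uniq (ports v);
  mem_ports : forall v u, (u \in ports v) = adj v u;
  id_of : V -> nat;
  id_of_inj : injective id_of
}.

Section Model.
Variables (V : finType) (G : input V).

Definition degree (v : V) : nat := #|[set u | adj G v u]|.

(* Content of the cell (a, j) of the array, where the row is named by the ID a.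
   Ports are numbered from 1.  The cell does not exist (None) when a is not the
   ID of a vertex or j exceeds the degree. *)
Definition cell (a j : nat) : option nat :=
  if [pick v | id_of G v == a] is Some v then
    if j is i.+1 then onth [seq id_of G u | u <- ports G v] i
    else Some (degree v)
  else None.

Definition weak_coloring (c : nat) (col : V -> 'I_c) : Prop :=
  forall v, 0 < degree v -> exists2 u, adj G v u & col u != col v.

End Model.

(* A deterministic adaptive computation whose only access to the input is by
   weak probes: [Probe a j k] reads the cell (a, j) and continues with k applied
   to its content. *)
Inductive probe_tree (A : Type) : Type :=
| Answer of A
| Probe of nat & nat & (nat -> probe_tree A).

(* The answer together with the number of probes made.  Probing a cell that does
   not exist yields None, so an algorithm that answers never does so. *)
Fixpoint run (A : Type) (V : finType) (G : input V) (t : probe_tree A) :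
    option (A * nat) :=
  match t with
  | Answer x => Some (x, 0)
  | Probe a j k =>
      if cell G a j is Some y then
        if run G (k y) is Some (x, q) then Some (x, q.+1) else None
      else None
  end.

(* An algorithm is given the number n of vertices and the ID of the queried
   vertex, and keeps no state between queries. *)
Definition lca (A : Type) : Type := nat -> nat -> probe_tree A.

Lemma up_log2_lt n : 1 < n -> up_log 2 n < n.
Proof.
case: n => [|[|n]] // _; rewrite ltnS.
by apply: up_log_min => //; apply: ltn_expl.
Qed.

Lemma log_star_ex n : exists i, iter i (up_log 2) n <= 1.
Proof.
elim/ltn_ind: n => n IH; have [n1|n1] := leqP n 1; first by exists 0.
by have [i Hi] := IH _ (up_log2_lt n1); exists i.+1; rewrite iterSr.
Qed.

(* The least i such that iterating log2 i times on n gives a value at most 1.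
   up_log 2 is the ceiling of log2; rounding up at each step does not change the
   count, since ceil (log2 (ceil x)) = ceil (log2 x) for x >= 1. *)
Definition log_star (n : nat) : nat := ex_minn (log_star_ex n).

(* Main.v *)
Require Import Defs.
From mathcomp Require Import all_boot.
From mathcomp Require Import zify.

(** Let every non-isolated vertex point to the neighbor at its first port. A
    coloring of this functional graph that is proper along the pointers is a
    weak coloring of the input, and following a pointer costs one probe.
    Starting from the IDs, each Cole-Vishkin round turns N colors into 2 * ceil
    (log2 N) colors and looks one pointer further, so log* n + O(1) rounds
    leave 6 colors. Each of the colors 5, 4, 3 is then removed at the cost of
    two more pointers: a shift-down gives all the vertices pointing to v the
    former color of v, so that v knows the colors around it without ever
    looking backwards. *)

Set Implicit Arguments.
Unset Strict Implicit.
Unset Printing Implicit Defensive.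

(** * Cole-Vishkin color reduction *)

Definition bit (i a : nat) : bool := odd (a %/ 2 ^ i).

Lemma eq_bits (L a b : nat) :
  a < 2 ^ L -> b < 2 ^ L -> (forall i, i < L -> bit i a = bit i b) -> a = b.
Proof.
elim: L a b => [|L IH] a b; first by rewrite expn0; lia.
rewrite expnS => aL bL eq_ab.
have e0 : odd a = odd b by have := eq_ab 0 isT; rewrite /bit expn0 !divn1.
have eS : a %/ 2 = b %/ 2.
  apply: IH => [||i iL]; try by rewrite ltn_divLR // mulnC.
  by have := eq_ab i.+1 iL; rewrite /bit expnS !divnMA.
by rewrite -[a]odd_double_half -[b]odd_double_half -!divn2 e0 eS.
Qed.

Definition differ (a b i : nat) : bool := bit i a != bit i b.

(** The window [a + b] is long enough for distinct numbers, since both are below [2 ^ (a + b)]; so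
    the step needs no bound on the colors. *)
Definition first_differ (a b : nat) : nat := find (differ a b) (iota 0 (a + b)).

Lemma differ_ex (L a b : nat) :
  a < 2 ^ L -> b < 2 ^ L -> a != b -> exists2 i, i < L & differ a b i.
Proof.
move=> aL bL neq_ab.
have [/hasP[i]|/hasPn no_diff] := boolP (has (differ a b) (iota 0 L)).
  by rewrite mem_iota; exists i.
case/eqP: neq_ab; apply: (eq_bits aL bL) => i iL.
by apply/eqP/negPn/no_diff; rewrite mem_iota.
Qed.

Lemma ltn_exp2_addr (a b : nat) : a < 2 ^ (a + b).
Proof.
by apply: leq_trans (ltn_expl a (ltnSn 1)) _; rewrite leq_exp2l // leq_addr.
Qed.

Lemma first_differP (L a b : nat) :
  a < 2 ^ L -> b < 2 ^ L -> a != b ->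
  first_differ a b < L /\ differ a b (first_differ a b).
Proof.
(* A difference below the minimum lies both below [L] and inside the searched window. *)
move=> aL bL neq_ab; set M := minn L (a + b).
have aM : a < 2 ^ M.
  by rewrite /M; case: (leqP L (a + b)) => // _; apply: ltn_exp2_addr.
have bM : b < 2 ^ M.
  by rewrite /M; case: (leqP L (a + b)) => // _; rewrite addnC ltn_exp2_addr.
have [i iM di] := differ_ex aM bM neq_ab.
have iab : i < a + b by rewrite (leq_trans iM) // geq_minr.
have has_diff : has (differ a b) (iota 0 (a + b)).
  by apply/hasP; exists i; rewrite // mem_iota.
split.
  apply: leq_ltn_trans (leq_trans iM (geq_minl _ _)); rewrite leqNgt.
  apply/negP=> lt_i; have := before_find 0 lt_i.
  by rewrite nth_iota // add0n di.
have := nth_find 0 has_diff; rewrite nth_iota // -[X in _ < X](size_iota 0).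
by rewrite -has_find.
Qed.

Definition cole_vishkin (a b : nat) : nat :=
  let i := first_differ a b in i.*2 + bit i a.

Lemma cole_vishkin_lt (N a b : nat) :
  a < N -> b < N -> a != b -> cole_vishkin a b < (up_log 2 N).*2.
Proof.
move=> aN bN neq_ab; have NL := up_logP N (ltnSn 1).
have [+ _] := first_differP (leq_trans aN NL) (leq_trans bN NL) neq_ab.
by rewrite /cole_vishkin; case: bit; lia.
Qed.

(** Equal new colors would share the index, by halving, and the bit of [a] and [b] there, yet [a]
    and [b] differ at that index. *)
Lemma cole_vishkin_neq (a b c : nat) :
  a != b -> b != c -> cole_vishkin a b != cole_vishkin b c.
Proof.
move=> neq_ab neq_bc.
have bL : b < 2 ^ (a + b) by rewrite addnC ltn_exp2_addr.
have [_ dab] := first_differP (ltn_exp2_addr a b) bL neq_ab.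
apply/eqP; rewrite /cole_vishkin => /= eq_cv.
have eq_i : first_differ a b = first_differ b c.
  by move: eq_cv; do 2![case: bit]; lia.
by move: dab eq_cv; rewrite /differ -eq_i; do 2![case: bit]; lia.
Qed.

(** * Removal of one color *)

Definition third_color (a b : nat) : nat :=
  find (fun x => (x != a) && (x != b)) [:: 0; 1; 2].

Lemma third_colorP (a b : nat) :
  [/\ third_color a b < 3, third_color a b != a & third_color a b != b].
Proof.
by rewrite /third_color; case: a => [|[|[|a]]]; case: b => [|[|[|b]]].
Qed.

(* New color of a vertex of color [a] whose next two successors have colors [b]
   and [d]: after the shift-down its color is [b], its successor has color [d]
   and all its predecessors have color [a]. *)
Definition recolor (m a b d : nat) : nat :=
  if b == m then third_color a d else b.

Lemma recolor_lt (m a b d : nat) : 3 <= m -> b < m.+1 -> recolor m a b d < m.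
Proof.
rewrite /recolor; case: eqP => [_|]; last by lia.
by have [] := third_colorP a d; lia.
Qed.

(** At most one of [b] and [d] equals [m], and the color replacing it avoids the other one. *)
Lemma recolor_neq (m a b d e : nat) :
  b != d -> recolor m a b d != recolor m b d e.
Proof.
rewrite /recolor => neq_bd.
have [_ _ ad] := third_colorP a d; have [_ be _] := third_colorP b e.
case: (b =P m) => [eq_b|_]; case: (d =P m) => [eq_d|_] //;
  last by rewrite eq_sym.
by rewrite eq_b eq_d eqxx in neq_bd.
Qed.

(** * Rounds on color lists and on a functional graph *)

Definition adjacent (A B : Type) (h : A -> A -> B) (s : seq A) : seq B :=
  if s is x :: s' then pairmap h x s' else [::].

Definition remove_color (m : nat) (s : seq nat) : seq nat :=
  adjacent (fun p q => recolor m p.1 p.2 q.2) (adjacent pair s).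

Definition final_color (t : nat) (s : seq nat) : nat :=
  head 0 (remove_color 3 (remove_color 4 (remove_color 5
    (iter t (adjacent cole_vishkin) s)))).

Section FunctionalGraph.
Variables (V : Type) (f : V -> V) (D : pred V).
Hypothesis closedD : forall v, D v -> D (f v).

(** Restricted to [D], later the non-isolated vertices, because an isolated vertex points to
    itself. *)
Definition proper (N : nat) (c : V -> nat) : Prop :=
  forall v, D v -> c v < N /\ c v != c (f v).

Definition cv_step (c : V -> nat) (v : V) : nat := cole_vishkin (c v) (c (f v)).

Definition remove_step (m : nat) (c : V -> nat) (v : V) : nat :=
  recolor m (c v) (c (f v)) (c (f (f v))).

Definition final_coloring (t : nat) (c : V -> nat) : V -> nat :=
  remove_step 3 (remove_step 4 (remove_step 5 (iter t cv_step c))).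

Lemma proper_widen (M N : nat) c : M <= N -> proper M c -> proper N c.
Proof. by move=> leMN pc v /pc[lt_c ->]; rewrite (leq_trans lt_c). Qed.

Lemma proper_cv_step (N : nat) c :
  proper N c -> proper (up_log 2 N).*2 (cv_step c).
Proof.
move=> pc v Dv; have [lt1 n1] := pc v Dv; have [lt2 n2] := pc _ (closedD Dv).
by rewrite cole_vishkin_lt // cole_vishkin_neq.
Qed.

Lemma proper_iter_cv_step (N t : nat) c :
  proper N c ->
  proper (iter t (fun M => (up_log 2 M).*2) N) (iter t cv_step c).
Proof. by move=> pc; elim: t => //= t; apply: proper_cv_step. Qed.

Lemma proper_remove_step (m : nat) c :
  3 <= m -> proper m.+1 c -> proper m (remove_step m c).
Proof.
move=> m3 pc v Dv; have [lt1 n1] := pc _ (closedD Dv).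
by rewrite recolor_lt // recolor_neq.
Qed.

Lemma proper_final_coloring (N t : nat) c :
  iter t (fun M => (up_log 2 M).*2) N <= 6 -> proper N c ->
  proper 3 (final_coloring t c).
Proof.
move=> le6 pc; do 3![apply: proper_remove_step => //].
by apply: (proper_widen le6); apply: proper_iter_cv_step.
Qed.

Lemma adjacent_traject (A B : Type) (h : A -> A -> B) (c : V -> A) v m :
  adjacent h (map c (traject f v m.+2)) =
  map (fun x => h (c x) (c (f x))) (traject f v m.+1).
Proof. by elim: m v => [|m IH] v //=; congr cons; have := IH (f v). Qed.

Lemma iter_cv_traject t c v m :
  iter t (adjacent cole_vishkin) (map c (traject f v (t + m).+1)) =
  map (iter t cv_step c) (traject f v m.+1).
Proof.
elim: t m => [|t IH] m //.
by rewrite iterS addSnnS IH adjacent_traject.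
Qed.

Lemma remove_color_traject k c v m :
  remove_color k (map c (traject f v m.+3)) =
  map (remove_step k c) (traject f v m.+1).
Proof. by rewrite /remove_color !adjacent_traject. Qed.

(** Each of the [t] rounds uses up one successor and each of the three removals two. *)
Lemma final_color_traject t c v :
  final_color t (map c (traject f v (t + 6).+1)) = final_coloring t c v.
Proof. by rewrite /final_color iter_cv_traject !remove_color_traject. Qed.

End FunctionalGraph.

(** * Number of rounds *)

Lemma up_log_mul (m n : nat) : up_log 2 (m * n) <= up_log 2 m + up_log 2 n.
Proof. by apply: up_log_min => //; rewrite expnD leq_mul ?up_logP. Qed.

Lemma leq_up_log2 (m n : nat) : m <= n -> up_log 2 m <= up_log 2 n.
Proof.
by move=> le_mn; apply: up_log_min => //; rewrite (leq_trans le_mn) ?up_logP.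
Qed.

(** Bounds the number of colors left after [log_star n + 1] rounds, and so also the number of
    further rounds needed to reach 6. *)
Definition extra_rounds (k : nat) : nat := (k + 3).*2.+2.

Definition rounds (k n : nat) : nat := extra_rounds k + (log_star n).+1.

(** Reduces to [2k + 8 <= 2 ^ (k + 3)], an equality at [k = 0]. *)
Lemma up_log_extra_rounds k :
  (up_log 2 (extra_rounds k)).*2.+2 <= extra_rounds k.
Proof.
rewrite /extra_rounds !ltnS leq_double; apply: up_log_min => //.
by elim: k => // k; rewrite addSn expnS; lia.
Qed.

(* The factor [K := extra_rounds k] is preserved because 2 log2 (K M) is at most
   2 log2 K + 2 log2 M, and K >= 2 log2 K + 2. *)
Lemma colors_leq_iter_log k n t :
  iter t.+1 (fun M => (up_log 2 M).*2) (n ^ k).+1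
    <= extra_rounds k * maxn 1 (iter t.+1 (up_log 2) n).
Proof.
elim: t => [|t IH].
  (* The first logarithm turns the exponent [k] into a factor, so the induction starts after one
     round. *)
  rewrite /= /extra_rounds.
  have: up_log 2 (n ^ k).+1 <= (up_log 2 n * k).+1.
    apply: up_log_min => //; rewrite expnS mulSn mul1n expnM.
    have : 0 < (2 ^ up_log 2 n) ^ k by rewrite !expn_gt0.
    suff: n ^ k <= (2 ^ up_log 2 n) ^ k by lia.
    by case: k => // k; rewrite leq_exp2r // up_logP.
  by rewrite /maxn; case: ltnP; nia.
rewrite iterS; set M := iter t.+1 _ n in IH *.
rewrite [X in maxn 1 X]iterS -/M.
have le1 := leq_trans (leq_up_log2 IH) (up_log_mul _ _).
have le2 : up_log 2 (maxn 1 M) <= maxn 1 (up_log 2 M).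
  by rewrite /(maxn 1 M); case: ltnP => _; rewrite ?up_log1 // leq_maxr.
have := up_log_extra_rounds k.
have : 0 < maxn 1 (up_log 2 M) by rewrite leq_max.
by nia.
Qed.

Lemma iter_log_star n : iter (log_star n) (up_log 2) n <= 1.
Proof. by rewrite /log_star; case: ex_minnP. Qed.

(** A round maps 6 to 6, and above 6 it loses at least one color. *)
Lemma double_up_log_leq N : (up_log 2 N).*2 <= maxn 6 N.-1.
Proof.
have [N8|N8] := leqP N 8.
  by have : up_log 2 N <= 3 by [apply: up_log_min]; lia.
suff : up_log 2 N <= N.-1./2 by lia.
apply: up_log_min => //.
(* From the base cases 9 and 10, adding 2 to [N] doubles the power. *)
have -> : N = (N - 9) + 9 by lia.
elim/ltn_ind: (N - 9) => [[|[|m]]] // IH.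
have -> : (m.+2 + 9).-1./2 = ((m + 9).-1./2).+1 by lia.
by rewrite expnS; have := IH m; lia.
Qed.

Lemma iter_double_up_log_leq i N :
  iter i (fun M => (up_log 2 M).*2) N <= maxn 6 (N - i).
Proof.
elim: i => [|i IH]; first by rewrite subn0 leq_maxr.
rewrite iterS; set M := iter i _ N in IH *.
by have := double_up_log_leq M; lia.
Qed.

Lemma colors_after_rounds k n :
  iter (rounds k n) (fun M => (up_log 2 M).*2) (n ^ k).+1 <= 6.
Proof.
rewrite /rounds iterD; set N := iter _.+1 _ _.
have leN : N <= extra_rounds k.
  apply: leq_trans (colors_leq_iter_log _ _ _) _.
  have := leq_up_log2 (iter_log_star n); rewrite up_log1 /= leqn0 => /eqP->.
  by rewrite maxn0 muln1.
by have := iter_double_up_log_leq (extra_rounds k) N; lia.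
Qed.

(** * The algorithm and its probes *)

Fixpoint walk (A : Type) (m a : nat) (g : seq nat -> A) : probe_tree A :=
  if m is m'.+1 then Probe a 1 (fun b => walk m' b (fun s => g (a :: s)))
  else Answer (g [:: a]).

(** The degree is probed first because an isolated vertex has no cell at port 1, and probing it
    would make the run fail. *)
Definition weak3 (k : nat) : lca 'I_3 := fun n a =>
  Probe a 0 (fun d =>
    if d == 0 then Answer ord0
    else walk (rounds k n + 6) a (fun s => inord (final_color (rounds k n) s))).

Section Input.
Variables (V : finType) (G : input V).

Definition first_port (v : V) : V := head v (ports G v).

Lemma cell_id (v : V) j :
  cell G (id_of G v) j =
  if j is i.+1 then onth [seq id_of G u | u <- ports G v] i
  else Some (degree G v).
Proof.
rewrite /cell; case: pickP => [u /eqP/id_of_inj-> //|/(_ v)].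
by rewrite eqxx.
Qed.

Lemma degree_gt0 (v : V) : (0 < degree G v) = (ports G v != [::]).
Proof.
rewrite /degree card_gt0; apply/set0Pn/idP => [[u]|].
  by rewrite inE -mem_ports; case: ports.
by case E: ports => [//|u s] _; exists u; rewrite inE -mem_ports E mem_head.
Qed.

Lemma adj_first_port (v : V) : 0 < degree G v -> adj G v (first_port v).
Proof.
rewrite degree_gt0 -mem_ports /first_port.
by case: ports => // u s _; apply: mem_head.
Qed.

Lemma degree_first_port (v : V) :
  0 < degree G v -> 0 < degree G (first_port v).
Proof.
move=> /adj_first_port; rewrite adj_sym => adj_fv.
by rewrite card_gt0; apply/set0Pn; exists v; rewrite inE.
Qed.

Lemma run_probe (A : Type) a j (h : nat -> probe_tree A) :
  run G (Probe a j h) =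
  if cell G a j is Some y then
    if run G (h y) is Some (x, q) then Some (x, q.+1) else None
  else None.
Proof. by []. Qed.

Lemma run_walk (A : Type) m (v : V) (g : seq nat -> A) :
  0 < degree G v ->
  run G (walk m (id_of G v) g) =
  Some (g [seq id_of G u | u <- traject first_port v m.+1], m).
Proof.
elim: m v g => [|m IH] v g Dv //.
have cell1 : cell G (id_of G v) 1 = Some (id_of G (first_port v)).
  by move: Dv; rewrite cell_id degree_gt0 /first_port; case: ports.
by rewrite run_probe cell1 IH // degree_first_port.
Qed.

End Input.

Theorem theorem1 (k : nat) :
  exists (alg : lca 'I_3) (C : nat),
  forall (V : finType) (G : input V),
    (forall v : V, id_of G v <= #|V| ^ k) ->
    exists col : V -> 'I_3,
      weak_coloring G col /\
      forall v : V, exists q : nat,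
        run G (alg #|V| (id_of G v)) = Some (col v, q) /\
        q <= log_star #|V| + C.
Proof.
(* The 8 counts the degree probe, six pointers for the removals, and the one round beyond [log_star]
   and [extra_rounds]. *)
exists (weak3 k), (extra_rounds k + 8) => V G id_le.
pose t := rounds k #|V|; pose f := first_port G.
pose c := final_coloring f t (id_of G).
have closedD v : 0 < degree G v -> 0 < degree G (f v).
  exact: degree_first_port.
have proper_c : proper f (fun v => 0 < degree G v) 3 c.
  apply: (proper_final_coloring closedD (colors_after_rounds k #|V|)) => v Dv.
  split; first exact: id_le.
  apply/eqP=> /id_of_inj eq_v.
  by have := adj_first_port Dv; rewrite -/f -/(f v) -eq_v adj_irr.
exists (fun v => if degree G v == 0 then ord0 else inord (c v)).
split=> [v Dv|v].
  exists (f v); first exact: adj_first_port.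
  have [lt_c neq_c] := proper_c v Dv.
  have [lt_cf _] := proper_c _ (closedD v Dv).
  have := closedD v Dv; rewrite -val_eqE /= !eqn0Ngt Dv => -> /=.
  by rewrite !inordK // eq_sym.
rewrite run_probe cell_id; case: eqP => [_|/eqP].
  by exists 1; split=> //; lia.
rewrite -lt0n => Dv; rewrite run_walk // final_color_traject.
by exists (t + 6).+1; split=> //; rewrite /t /rounds; lia.
Qed.
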